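(* Suppose $C_i\subset\mathbb{R}^3$ for $i=1,2$ are disjoint oriented (smoothly embedded, closed) curves, not necessarily Legendrian, with respective smooth parametrizations $X_i:S^1\to\mathbb{R}^3$ compatible with the orientations. Then for every $\Lambda>0$ $$\mathsf{lk}(C_1,C_2)=\int_{T^2}(X_1\times X_2)^*\,\widehat\Gamma^*\chi_\Lambda .$$
   Context: The torus $T^2=S^1\times S^1$ has angular coordinates $(\theta_1,\theta_2)$ and orientation $d\theta_1\wedge d\theta_2$; $\mathbb{R}^3$ has coordinates $(x,y,z)$ and orientation $dx\wedge dy\wedge dz$. The Heisenberg difference $\widehat\Gamma:\mathbb{R}^3\times\mathbb{R}^3\to\mathbb{R}^3$ is $$\widehat\Gamma(X_1,X_2)=\big(x_2-x_1,\ y_2-y_1,\ z_2-z_1+x_1y_2-x_2y_1\big).$$ For $\Lambda>0$ the heat form $\chi_\Lambda\in\Omega^2(\mathbb{R}^3-\{0\})$ is $$\chi_\Lambda=\frac{\Lambda}{2\pi z}\,e^{-\Lambda(x^2+y^2)/2z}\Big[dx\wedge dy+\tfrac12(x\,dy-y\,dx)\wedge\frac{dz}{z}\Big]\ \text{ for } z>0,\qquad \chi_\Lambda=0\ \text{ for } z\le 0.$$ The linking number $\mathsf{lk}(C_1,C_2)$ is the degree of the map $T^2\to S^2$, $(\theta_1,\theta_2)\mapsto (X_2(\theta_2)-X_1(\theta_1))/\|X_2(\theta_2)-X_1(\theta_1)\|$, where $S^2\subset\mathbb{R}^3$ carries the orientation induced from $dx\wedge dy\wedge dz$; equivalently it is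 given by the Gauss integral $\int_{T^2}(X_1\times X_2)^*\Gamma^*\psi$, with $\Gamma(X_1,X_2)=X_2-X_1$ and $\psi=\frac{1}{4\pi}\,\frac{x\,dy\wedge dz-y\,dx\wedge dz+z\,dx\wedge dy}{(x^2+y^2+z^2)^{3/2}}$. *)

(* Defs.v *)
From Stdlib Require Import Reals ZArith.
From Coquelicot Require Import Coquelicot.
Open Scope R_scope.

Definition R3 : Type := (R * R * R)%type.

Definition xc (p : R3) : R := fst (fst p).
Definition yc (p : R3) : R := snd (fst p).
Definition zc (p : R3) : R := snd p.

Definition sub3 (p q : R3) : R3 := (xc p - xc q, yc p - yc q, zc p - zc q).
Definition norm3 (p : R3) : R := sqrt (xc p ^ 2 + yc p ^ 2 + zc p ^ 2).
Definition unit3 (p : R3) : R3 := (xc p / norm3 p, yc p / norm3 p, zc p / norm3 p).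

(** A form takes a base point first, then tangent vectors. *)
Definition form1 : Type := R3 -> R3 -> R.
Definition form2 : Type := R3 -> R3 -> R3 -> R.

Definition dx : form1 := fun _ v => xc v.
Definition dy : form1 := fun _ v => yc v.
Definition dz : form1 := fun _ v => zc v.

Definition wedge (a b : form1) : form2 :=
  fun p u v => a p u * b p v - a p v * b p u.

(** The circle is [R] modulo [2 * PI]: a map out of [S^1] is a [2 * PI]-periodic
    function of the angle, a map out of [T^2] a function that is
    [2 * PI]-periodic in each of its two angles. *)
Definition derive3 (X : R -> R3) (t : R) : R3 :=
  (Derive (fun s => xc (X s)) t,
   Derive (fun s => yc (X s)) t,
   Derive (fun s => zc (X s)) t).

Definition smooth3 (X : R -> R3) : Prop :=
  forall (n : nat) (t : R),
    ex_derive_n (fun s => xc (X s)) n t /\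
    ex_derive_n (fun s => yc (X s)) n t /\
    ex_derive_n (fun s => zc (X s)) n t.

(** A smooth embedding of the circle; it stands for its image, oriented by
    increasing angle. *)
Record embedded_circle (X : R -> R3) : Prop := {
  circle_periodic : forall t, X (t + 2 * PI) = X t;
  circle_smooth : smooth3 X;
  circle_immersed : forall t, derive3 X t <> (0, 0, 0);
  circle_injective :
    forall s t, X s = X t -> exists k : Z, t = s + 2 * PI * IZR k
}.

(** The coefficient of [dtheta1 /\ dtheta2] in the pullback of [w] by [F]. *)
Definition pullback (F : R -> R -> R3) (w : form2) (t1 t2 : R) : R :=
  w (F t1 t2) (derive3 (fun s => F s t2) t1) (derive3 (fun s => F t1 s) t2).

(** The integral of the 2-form [f dtheta1 /\ dtheta2] over the torus oriented by
    [dtheta1 /\ dtheta2]. *)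
Definition integral_T2 (f : R -> R -> R) : R :=
  RInt (fun t1 => RInt (fun t2 => f t1 t2) 0 (2 * PI)) 0 (2 * PI).

(** Restricted to the unit sphere, this is the area form for the boundary
    orientation (outward normal first); its integral over the sphere is
    [4 * PI]. *)
Definition sphere_area : form2 :=
  fun p u v =>
    xc p * wedge dy dz p u v - yc p * wedge dx dz p u v
    + zc p * wedge dx dy p u v.

(** The de Rham degree of a smooth map [f] from the torus to the unit sphere:
    the integral of the pullback of the area form of total mass 1. *)
Definition degree_T2_S2 (f : R -> R -> R3) : R :=
  integral_T2 (pullback f (fun p u v => / (4 * PI) * sphere_area p u v)).

Definition linking_number (X1 X2 : R -> R3) : R :=
  degree_T2_S2 (fun t1 t2 => unit3 (sub3 (X2 t2) (X1 t1))).

Definition heisenberg_diff (p1 p2 : R3) : R3 :=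
  (xc p2 - xc p1,
   yc p2 - yc p1,
   zc p2 - zc p1 + xc p1 * yc p2 - xc p2 * yc p1).

Definition heat_form (Lambda : R) : form2 :=
  fun p u v =>
    let x := xc p in let y := yc p in let z := zc p in
    if Rlt_dec 0 z then
      Lambda / (2 * PI * z) * exp (- Lambda * (x ^ 2 + y ^ 2) / (2 * z)) *
      (wedge dx dy p u v
       + / 2 * wedge (fun q w => xc q * dy q w - yc q * dx q w)
                     (fun q w => dz q w / zc q) p u v)
    else 0.

(* Main.v *)
Require Import Defs.
From Stdlib Require Import Reals ZArith Lra.
From Coquelicot Require Import Coquelicot.
Open Scope R_scope.

(** Write [r, phi] for the polar coordinates of [(x, y)], [rho] for the Euclidean
    norm, and [u = Lambda r^2 / (2 z)].  Then the Gauss form is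
    [psi = d (- (z / rho) dphi) / (4 PI)] and, for [z > 0],
    [chi = d (- exp (- u) dphi) / (2 PI)].  The Euclidean and the Heisenberg
    difference have the same [x] and [y], hence the same [dphi], and only differ in
    the third coordinate, [z] against [w].  On the torus, therefore, the two
    pullbacks differ by the exterior derivative of
    [(exp (- u) - (1 + z / rho) / 2) dphi / (2 PI)], where [exp (- u)] is taken at
    [w] and means [0] for [w <= 0].  The constant [1/2] makes the coefficient vanish
    to order [r^2] where [r = 0]: there [w = z <> 0], and it tends to [1 - 1] if
    [z > 0] and to [0 - 0] if [z < 0].  The 1-form is thus of class C^1 on the whole
    torus, and Stokes' theorem gives the equality of the integrals. *)

(** * Functions of class C^1 *)

(** The derivative is a witness [h'] valid on a neighbourhood, so that [Derive h] agrees with it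
    near [x] and inherits its continuity at [x]. *)
Definition C1_at (h : R -> R) (x : R) : Prop :=
  exists h' : R -> R, locally x (fun y => is_derive h y (h' y)) /\ continuous h' x.

(** Joint continuity of [F] is recorded with the partial derivatives because the product and chain
    rules use it. *)
Definition C1_2d_at (F : R -> R -> R) (u v : R) : Prop :=
  exists F1 F2 : R * R -> R,
    locally (u, v) (fun q =>
      is_derive (fun s => F s (snd q)) (fst q) (F1 q) /\
      is_derive (fun t => F (fst q) t) (snd q) (F2 q)) /\
    continuous F1 (u, v) /\ continuous F2 (u, v) /\
    continuous (fun q : R * R => F (fst q) (snd q)) (u, v).

Lemma C1_2d_const (c u v : R) : C1_2d_at (fun _ _ => c) u v.
Proof.
  exists (fun _ => 0), (fun _ => 0). repeat split; try apply continuous_const.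
  apply filter_forall; intros q; split; apply @is_derive_const.
Qed.

(** Allows a function defined by cases, such as [potential] below, to be replaced near each point by
    a single formula. *)
Lemma C1_2d_ext_loc (F G : R -> R -> R) (u v : R) :
  locally (u, v) (fun q => F (fst q) (snd q) = G (fst q) (snd q)) ->
  C1_2d_at F u v -> C1_2d_at G u v.
Proof.
  intros HE (F1 & F2 & HD & H1 & H2 & H0).
  exists F1, F2; repeat split; trivial.
  - generalize (filter_and _ _ (locally_locally _ _ HE) HD).
    apply filter_imp; intros [s t] [HL [D1 D2]]; simpl in *; split.
    + apply is_derive_ext_loc with (2 := D1).
      apply (locally_2d_1d_const_y (fun a b => F a b = G a b) s t).
      now apply locally_2d_locally.
    + apply is_derive_ext_loc with (2 := D2).
      apply (locally_2d_1d_const_x (fun a b => F a b = G a b) s t).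
      now apply locally_2d_locally.
  - now apply continuous_ext_loc with (2 := H0).
Qed.

Lemma C1_2d_plus (F G : R -> R -> R) (u v : R) :
  C1_2d_at F u v -> C1_2d_at G u v -> C1_2d_at (fun s t => F s t + G s t) u v.
Proof.
  intros (F1 & F2 & HD & H1 & H2 & H0) (G1 & G2 & KD & K1 & K2 & K0).
  exists (fun q => F1 q + G1 q), (fun q => F2 q + G2 q).
  repeat split; try now apply @continuous_plus.
  generalize (filter_and _ _ HD KD).
  apply filter_imp; intros q [[A B] [C D]]; split.
  - now apply (is_derive_plus (fun s => F s (snd q)) (fun s => G s (snd q))).
  - now apply (is_derive_plus (fun t => F (fst q) t) (fun t => G (fst q) t)).
Qed.

Lemma C1_2d_mult (F G : R -> R -> R) (u v : R) :
  C1_2d_at F u v -> C1_2d_at G u v -> C1_2d_at (fun s t => F s t * G s t) u v.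
Proof.
  intros (F1 & F2 & HD & H1 & H2 & H0) (G1 & G2 & KD & K1 & K2 & K0).
  exists (fun q => F1 q * G (fst q) (snd q) + F (fst q) (snd q) * G1 q),
         (fun q => F2 q * G (fst q) (snd q) + F (fst q) (snd q) * G2 q).
  repeat split;
    try (now apply @continuous_mult);
    try (apply @continuous_plus; now apply @continuous_mult).
  generalize (filter_and _ _ HD KD).
  apply filter_imp; intros q [[A B] [C D]]; split.
  - apply (is_derive_mult (fun s => F s (snd q)) (fun s => G s (snd q)));
      trivial; apply Rmult_comm.
  - apply (is_derive_mult (fun t => F (fst q) t) (fun t => G (fst q) t));
      trivial; apply Rmult_comm.
Qed.

Lemma C1_2d_comp (h : R -> R) (F : R -> R -> R) (u v : R) :
  C1_at h (F u v) -> C1_2d_at F u v -> C1_2d_at (fun s t => h (F s t)) u v.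
Proof.
  intros (h' & HD & H1) (F1 & F2 & KD & K1 & K2 & K0).
  assert (Kh' : continuous (fun q : R * R => h' (F (fst q) (snd q))) (u, v))
    by now apply (continuous_comp (fun q : R * R => F (fst q) (snd q)) h').
  exists (fun q => F1 q * h' (F (fst q) (snd q))),
         (fun q => F2 q * h' (F (fst q) (snd q))).
  repeat split; try now apply @continuous_mult.
  (* Continuity of [F] pulls the neighbourhood of [F u v] on which [h] is differentiable back to a
     neighbourhood of [(u, v)]. *)
  - generalize (filter_and _ _ KD (K0 _ HD)).
    apply filter_imp; intros q [[A B] C]; simpl in C; split.
    + now apply (is_derive_comp h (fun s => F s (snd q))).
    + now apply (is_derive_comp h (fun t => F (fst q) t)).
  - apply (continuous_comp (fun q : R * R => F (fst q) (snd q)) h); trivial.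
    apply (@ex_derive_continuous R_AbsRing R_NormedModule).
    exists (h' (F u v)). exact (locally_singleton _ _ HD).
Qed.

Lemma C1_2d_opp (F : R -> R -> R) (u v : R) :
  C1_2d_at F u v -> C1_2d_at (fun s t => - F s t) u v.
Proof.
  intros HF. apply (C1_2d_comp Ropp F); trivial.
  exists (fun _ => -1); split; [|apply continuous_const].
  apply filter_forall; intros y.
  auto_derive; trivial; ring.
Qed.

Lemma C1_2d_minus (F G : R -> R -> R) (u v : R) :
  C1_2d_at F u v -> C1_2d_at G u v -> C1_2d_at (fun s t => F s t - G s t) u v.
Proof. intros HF HG. apply C1_2d_plus; trivial. now apply C1_2d_opp. Qed.

Lemma C1_inv (x : R) : x <> 0 -> C1_at Rinv x.
Proof.
  intros Hx. exists (fun y => - / (y * y)); split.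
  - assert (HN : locally x (fun y => y <> 0)) by exact (open_neq 0 x Hx).
    revert HN; apply filter_imp; intros y Hy. auto_derive; trivial. now field.
  - apply @continuous_opp, continuous_Rinv_comp.
    + apply @continuous_mult; apply continuous_id.
    + now apply Rmult_integral_contrapositive_currified.
Qed.

Lemma C1_sqrt (x : R) : 0 < x -> C1_at sqrt x.
Proof.
  intros Hx. exists (fun y => / (2 * sqrt y)); split.
  - assert (HN : locally x (fun y => 0 < y)) by exact (open_gt 0 x Hx).
    revert HN; apply filter_imp; intros y Hy. auto_derive; trivial. field.
    now apply Rgt_not_eq, sqrt_lt_R0.
  - apply continuous_Rinv_comp.
    + apply @continuous_mult; [apply continuous_const | apply continuous_sqrt].
    + apply Rgt_not_eq, Rmult_lt_0_compat; [lra | now apply sqrt_lt_R0].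
Qed.

Lemma C1_2d_inv (F : R -> R -> R) (u v : R) :
  F u v <> 0 -> C1_2d_at F u v -> C1_2d_at (fun s t => / F s t) u v.
Proof. intros H. now apply C1_2d_comp, C1_inv. Qed.

Lemma C1_2d_sqrt (F : R -> R -> R) (u v : R) :
  0 < F u v -> C1_2d_at F u v -> C1_2d_at (fun s t => sqrt (F s t)) u v.
Proof. intros H. now apply C1_2d_comp, C1_sqrt. Qed.

Lemma C1_2d_fst (h : R -> R) (u v : R) : C1_at h u -> C1_2d_at (fun s _ => h s) u v.
Proof.
  intros (h' & HD & Hh).
  exists (fun q => h' (fst q)), (fun _ => 0). repeat split.
  - assert (HN : locally (u, v) (fun q => is_derive h (fst q) (h' (fst q))))
      by exact (continuous_fst u v _ HD).
    revert HN; apply filter_imp; intros q Hq; split; trivial. apply @is_derive_const.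
  - now apply (continuous_comp fst h' (u, v)); [apply continuous_fst|].
  - apply continuous_const.
  - apply (continuous_comp fst h (u, v)); [apply continuous_fst|].
    apply (@ex_derive_continuous R_AbsRing R_NormedModule).
    exists (h' u). exact (locally_singleton _ _ HD).
Qed.

Lemma C1_2d_snd (h : R -> R) (u v : R) : C1_at h v -> C1_2d_at (fun _ t => h t) u v.
Proof.
  intros (h' & HD & Hh).
  exists (fun _ => 0), (fun q => h' (snd q)). repeat split.
  - assert (HN : locally (u, v) (fun q => is_derive h (snd q) (h' (snd q))))
      by exact (continuous_snd u v _ HD).
    revert HN; apply filter_imp; intros q Hq; split; trivial. apply @is_derive_const.
  - apply continuous_const.
  - now apply (continuous_comp snd h' (u, v)); [apply continuous_snd|].
  - apply (continuous_comp snd h (u, v)); [apply continuous_snd|].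
    apply (@ex_derive_continuous R_AbsRing R_NormedModule).
    exists (h' v). exact (locally_singleton _ _ HD).
Qed.

Lemma C1_2d_ex_derive (F : R -> R -> R) (u v : R) : C1_2d_at F u v ->
  ex_derive (fun s => F s v) u /\ ex_derive (fun t => F u t) v.
Proof.
  intros (F1 & F2 & HD & _). destruct (locally_singleton _ _ HD) as [A B].
  split; eexists; eassumption.
Qed.

Lemma C1_2d_continuous (F : R -> R -> R) (u v : R) :
  C1_2d_at F u v -> continuous (fun q : R * R => F (fst q) (snd q)) (u, v).
Proof. now intros (F1 & F2 & _ & _ & _ & H). Qed.

Lemma C1_2d_continuous_Derive (F : R -> R -> R) (u v : R) : C1_2d_at F u v ->
  continuous (fun q : R * R => Derive (fun s => F s (snd q)) (fst q)) (u, v) /\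
  continuous (fun q : R * R => Derive (fun t => F (fst q) t) (snd q)) (u, v).
Proof.
  intros (F1 & F2 & HD & H1 & H2 & _). split.
  - apply continuous_ext_loc with (2 := H1).
    revert HD; apply filter_imp; intros q [A _]. symmetry. now apply is_derive_unique.
  - apply continuous_ext_loc with (2 := H2).
    revert HD; apply filter_imp; intros q [_ A]. symmetry. now apply is_derive_unique.
Qed.

(** * The profiles [exp (- 1 / v)] and [(exp x - 1) / x] *)

(** At [v = 2 w / (Lambda r2)] this is [exp (- u)] for [w > 0] and [0] for [w <= 0]: both cases of
    the heat form come from one C^1 function. *)
Definition flat (v : R) : R := if Rlt_dec 0 v then exp (- / v) else 0.

(* From [exp (w/3) >= w/3], cubed, at [w = 1/v]. *)
Lemma flat_le_cube (v : R) : 0 < v -> 0 <= flat v <= 27 * v ^ 3.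
Proof.
  intros Hv. unfold flat. destruct (Rlt_dec 0 v); [|lra].
  split; [left; apply exp_pos|].
  assert (Hw : 0 < / v) by now apply Rinv_0_lt_compat.
  assert (He : / v / 3 <= exp (/ v / 3)) by (generalize (exp_ineq1_le (/ v / 3)); lra).
  assert (Hc : (/ v / 3) ^ 3 <= exp (/ v)).
  { replace (exp (/ v)) with (exp (/ v / 3) ^ 3).
    - apply pow_incr; lra.
    - simpl. rewrite Rmult_1_r, <- !exp_plus. f_equal. field. lra. }
  rewrite exp_Ropp.
  replace (27 * v ^ 3) with (/ ((/ v / 3) ^ 3)) by (field; lra).
  apply Rinv_le_contravar; trivial.
  apply pow_lt; lra.
Qed.

(** The formula also covers [v = 0]: there [flat v = 0], so the quotient is [0] whatever the inverse
    of [0] is, and the cubic bound makes the derivative vanish. *)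
Lemma is_derive_flat (v : R) : is_derive flat v (flat v / v ^ 2).
Proof.
  destruct (Rtotal_order v 0) as [Hv | [-> | Hv]].
  - apply is_derive_ext_loc with (fun _ => 0).
    + assert (HN : locally v (fun y => y < 0)) by exact (open_lt 0 v Hv).
      revert HN; apply filter_imp; intros y Hy.
      unfold flat; destruct (Rlt_dec 0 y); lra.
    + replace (flat v / v ^ 2) with 0.
      * apply @is_derive_const.
      * unfold flat; destruct (Rlt_dec 0 v); [lra|]. unfold Rdiv; ring.
  - replace (flat 0 / 0 ^ 2) with 0
      by (unfold flat; destruct (Rlt_dec 0 0); [lra|]; unfold Rdiv; ring).
    apply is_derive_Reals. intros eps Heps.
    (* For [0 < h < 1] the difference quotient is at most [27 h^2 <= 27 h], which is below [eps]
       once [h < eps / 27]. *)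
    assert (Hd : 0 < Rmin 1 (eps / 27)) by (apply Rmin_pos; lra).
    exists (mkposreal _ Hd). intros h Hh0 Hh. simpl in Hh.
    assert (Hh1 := Rlt_le_trans _ _ _ Hh (Rmin_l _ _)).
    assert (Hh2 := Rlt_le_trans _ _ _ Hh (Rmin_r _ _)).
    rewrite Rplus_0_l.
    replace (flat 0) with 0 by (unfold flat; destruct (Rlt_dec 0 0); lra).
    unfold Rminus. rewrite Ropp_0, !Rplus_0_r.
    destruct (Rlt_dec 0 h) as [Hp | Hn].
    + destruct (flat_le_cube h Hp) as [L U].
      rewrite Rabs_pos_eq in Hh1, Hh2 by lra.
      rewrite Rabs_pos_eq
        by (apply Rmult_le_pos; [easy | left; now apply Rinv_0_lt_compat]).
      apply Rmult_lt_reg_r with h; trivial.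
      unfold Rdiv; rewrite Rmult_assoc, Rinv_l, Rmult_1_r by lra.
      apply Rle_lt_trans with (1 := U). simpl in *; nra.
    + unfold flat; destruct (Rlt_dec 0 h); [lra|].
      unfold Rdiv; rewrite Rmult_0_l, Rabs_R0; trivial.
  - apply is_derive_ext_loc with (fun y => exp (- / y)).
    + assert (HN : locally v (fun y => 0 < y)) by exact (open_gt 0 v Hv).
      revert HN; apply filter_imp; intros y Hy.
      unfold flat; destruct (Rlt_dec 0 y); lra.
    + unfold flat; destruct (Rlt_dec 0 v); [|lra].
      auto_derive; [lra | field; lra].
Qed.

Lemma C1_flat (v : R) : C1_at flat v.
Proof.
  exists (fun y => flat y / y ^ 2); split.
  - apply filter_forall; intros y; apply is_derive_flat.
  - destruct (Req_dec v 0) as [-> | Hv].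
    + apply filterlim_locally. intros eps.
      (* The cubic bound gives [flat y / y^2 <= 27 y] for [y > 0]. *)
      assert (Hd : 0 < eps / 27) by (generalize (cond_pos eps); lra).
      exists (mkposreal _ Hd). intros y Hy.
      unfold ball in *; simpl in *; unfold AbsRing_ball, abs, minus, plus, opp in *; simpl in *.
      replace (flat 0 / (0 * (0 * 1))) with 0
        by (unfold flat; destruct (Rlt_dec 0 0); [lra|]; unfold Rdiv; ring).
      rewrite Ropp_0, Rplus_0_r in *.
      destruct (Rlt_dec 0 y) as [Hp | Hn].
      * destruct (flat_le_cube y Hp) as [L U].
        assert (Hyy : 0 < y * (y * 1)) by nra.
        rewrite Rabs_pos_eq in Hy by lra.
        rewrite Rabs_pos_eq.
        -- apply Rmult_lt_reg_r with (y * (y * 1)); trivial.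
           unfold Rdiv; rewrite Rmult_assoc, Rinv_l, Rmult_1_r by lra.
           apply Rle_lt_trans with (1 := U). simpl; nra.
        -- apply Rmult_le_pos; [easy | left; now apply Rinv_0_lt_compat].
      * unfold flat; destruct (Rlt_dec 0 y); [lra|].
        unfold Rdiv; rewrite Rmult_0_l, Rabs_R0; apply cond_pos.
    + apply @continuous_mult.
      * apply (@ex_derive_continuous R_AbsRing R_NormedModule).
        eexists; apply is_derive_flat.
      * apply continuous_Rinv_comp; [|now apply pow_nonzero].
        apply (@ex_derive_continuous R_AbsRing R_NormedModule). auto_derive; trivial.
Qed.

(** Shifting the exponential series gives the sum of [x^n / (n+1)!], the entire extension of
    [(exp x - 1) / x] across [0]. It makes [(exp (- u) - 1) / r2] regular on the axis [r2 = 0]. *)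
Definition expm1_div : R -> R := PSeries (PS_decr_1 (fun n => / INR (fact n))).

Lemma CV_radius_exp : CV_radius (fun n => / INR (fact n)) = p_infty.
Proof.
  apply CV_radius_infinite_DAlembert.
  - intros n; apply Rinv_neq_0_compat, INR_fact_neq_0.
  - apply is_lim_seq_ext with (fun n => / INR (S n)).
    + intros n. rewrite Rabs_pos_eq.
      * rewrite fact_simpl, mult_INR. field.
        split; [apply INR_fact_neq_0 | apply not_0_INR; discriminate].
      * apply Rmult_le_pos.
        -- left; apply Rinv_0_lt_compat, INR_fact_lt_0.
        -- left; apply Rinv_0_lt_compat, Rinv_0_lt_compat, INR_fact_lt_0.
    + apply (is_lim_seq_incr_1 (fun n => / INR n)).
      replace (Finite 0) with (Rbar_inv p_infty) by easy.
      apply is_lim_seq_inv; [apply is_lim_seq_INR | easy].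
Qed.

Lemma expm1_div_mult (x : R) : x * expm1_div x = exp x - 1.
Proof.
  rewrite exp_Reals, PSeries_decr_1.
  - unfold expm1_div. simpl. field.
  - exists (exp x). apply is_exp_Reals.
Qed.

Lemma expm1_div_0 : expm1_div 0 = 1.
Proof. unfold expm1_div. rewrite PSeries_0. unfold PS_decr_1. simpl. field. Qed.

Lemma C1_expm1_div (x : R) : C1_at expm1_div x.
Proof.
  exists (PSeries (PS_derive (PS_decr_1 (fun n => / INR (fact n))))); split.
  - apply filter_forall; intros y. apply is_derive_PSeries.
    now rewrite CV_radius_decr_1, CV_radius_exp.
  - apply continuity_pt_filterlim, PSeries_continuity.
    now rewrite CV_radius_derive, CV_radius_decr_1, CV_radius_exp.
Qed.

(** * Stokes' theorem on the torus *)

Definition C0_2d (F : R -> R -> R) : Prop :=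
  forall u v, continuous (fun q : R * R => F (fst q) (snd q)) (u, v).

Lemma continuous_section (D : R -> R -> R) (u v : R) :
  continuous (fun q : R * R => D (fst q) (snd q)) (u, v) ->
  continuous (fun t => D u t) v.
Proof.
  intros H. apply (continuous_comp_2 (fun _ => u) (fun t => t) D).
  - apply continuous_const.
  - apply continuous_id.
  - exact H.
Qed.

(** Follows from the uniform continuity of [D] on the compact rectangle [[x-1, x+1] * [a, b]]. *)
Lemma continuous_RInt_param (D : R -> R -> R) (a b : R) :
  a <= b -> C0_2d D ->
  forall x, continuous (fun u => RInt (D u) a b) x.
Proof.
  intros Hab HD x.
  assert (HI : forall u, ex_RInt (D u) a b).
  { intros u. apply @ex_RInt_continuous. intros; now apply continuous_section. }
  apply filterlim_locally. intros eps.
  (* The [+ 1] keeps the denominator positive when [a = b] and makes the final bound strictly less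
     than [eps]. *)
  assert (He : 0 < eps / (b - a + 1))
    by (apply Rdiv_lt_0_compat; [apply cond_pos | lra]).
  destruct (uniform_continuity_2d D (x - 1) (x + 1) a b) with (mkposreal _ He)
    as [d Hd].
  { intros u v _ _. apply continuity_2d_pt_filterlim. apply HD. }
  assert (Hm : 0 < Rmin 1 d) by (apply Rmin_pos; [lra | apply cond_pos]).
  exists (mkposreal _ Hm). intros y Hy.
  unfold ball in *; simpl in *; unfold AbsRing_ball, abs, minus, plus, opp in *; simpl in *.
  assert (Hy1 := Rlt_le_trans _ _ _ Hy (Rmin_l _ _)).
  assert (Hy2 := Rlt_le_trans _ _ _ Hy (Rmin_r _ _)).
  apply Rabs_def2 in Hy1.
  change (Rabs (minus (RInt (D y) a b) (RInt (D x) a b)) < eps).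
  rewrite <- RInt_minus by trivial.
  apply Rle_lt_trans with ((b - a) * (eps / (b - a + 1))).
  - apply (norm_RInt_le_const (fun t => minus (D y t) (D x t)) a b); trivial.
    + intros t Ht. left. apply Hd; try lra; trivial.
      rewrite Rminus_eq_0, Rabs_R0. apply cond_pos.
    + apply @RInt_correct, @ex_RInt_minus; trivial.
  - replace ((b - a) * (eps / (b - a + 1))) with (eps - eps / (b - a + 1))
      by (field; lra). simpl in He. lra.
Qed.

(** Differentiation under the integral sign makes the outer integrand the derivative of
    [u |-> RInt (A u) 0 T], whose values at [0] and [T] coincide. The order of integration is never
    exchanged. *)
Lemma RInt_Derive_fst (A : R -> R -> R) (T : R) :
  0 <= T -> C0_2d A ->
  (forall u v, ex_derive (fun s => A s v) u) ->
  C0_2d (fun u v => Derive (fun s => A s v) u) ->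
  (forall v, A T v = A 0 v) ->
  is_RInt (fun u => RInt (fun v => Derive (fun s => A s v) u) 0 T) 0 T 0.
Proof.
  intros HT HA Hex HD Hper.
  assert (HE : minus (RInt (fun v => A T v) 0 T) (RInt (fun v => A 0 v) 0 T) = 0).
  { rewrite (RInt_ext (fun v => A T v) (fun v => A 0 v)) by (intros; apply Hper).
    apply (@minus_eq_zero R_AbelianGroup). }
  refine (eq_ind _ (is_RInt _ 0 T) _ _ HE).
  apply (is_RInt_derive (fun u => RInt (fun v => A u v) 0 T)).
  - intros u _. apply is_derive_RInt_param.
    + apply filter_forall; intros; apply Hex.
    + intros t _. apply continuity_2d_pt_filterlim. apply HD.
    + apply filter_forall; intros s.
      apply @ex_RInt_continuous. intros; now apply continuous_section.
  - intros u _. now apply continuous_RInt_param.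
Qed.

(** Stokes for the 1-form [B dtheta1 + A dtheta2]. The [B] term integrates to [0] in the inner
    variable, the [A] term in the outer one. Continuity is asked of [f] alone: the integrals of [g],
    here the piecewise heat integrand, are computed from [g = f - a + dB/dv]. *)
Lemma integral_T2_exact (A B f g : R -> R -> R) :
  C0_2d A ->
  (forall u v, ex_derive (fun s => A s v) u) ->
  (forall u v, ex_derive (fun t => B u t) v) ->
  C0_2d (fun u v => Derive (fun s => A s v) u) ->
  C0_2d (fun u v => Derive (fun t => B u t) v) ->
  (forall v, A (2 * PI) v = A 0 v) ->
  (forall u, B u (2 * PI) = B u 0) ->
  C0_2d f ->
  (forall u v, f u v - g u v =
     Derive (fun s => A s v) u - Derive (fun t => B u t) v) ->
  integral_T2 f = integral_T2 g.
Proof.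
  intros HA HexA HexB HDA HDB HpA HpB Hf Hfg. unfold integral_T2.
  assert (H2PI : 0 <= 2 * PI) by (generalize PI_RGT_0; lra).
  assert (HinnerB : forall u, is_RInt (fun t => Derive (fun t => B u t) t) 0 (2 * PI) 0).
  { intros u.
    assert (HE : minus (B u (2 * PI)) (B u 0) = 0)
      by (rewrite HpB; apply (@minus_eq_zero R_AbelianGroup)).
    refine (eq_ind _ (is_RInt _ 0 (2 * PI)) _ _ HE).
    apply (is_RInt_derive (fun t => B u t)).
    - intros t _. apply Derive_correct, HexB.
    - intros t _. now apply (continuous_section (fun u t => Derive (fun t => B u t) t)). }
  assert (Hinner : forall F u, C0_2d F -> ex_RInt (fun v => F u v) 0 (2 * PI)).
  { intros F u HF. apply @ex_RInt_continuous. intros; now apply continuous_section. }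
  assert (Houter : forall F, C0_2d F ->
    ex_RInt (fun u => RInt (fun v => F u v) 0 (2 * PI)) 0 (2 * PI)).
  { intros F HF. apply @ex_RInt_continuous. intros; now apply continuous_RInt_param. }
  set (a := fun u v => Derive (fun s => A s v) u) in *.
  assert (Hg : forall u, RInt (fun v => g u v) 0 (2 * PI) =
    minus (RInt (fun v => f u v) 0 (2 * PI)) (RInt (fun v => a u v) 0 (2 * PI))).
  { intros u. rewrite <- RInt_minus by now apply Hinner.
    set (h := fun v => minus (f u v) (a u v)).
    transitivity (RInt (fun v => h v + Derive (fun t => B u t) v) 0 (2 * PI)).
    - apply RInt_ext; intros v _.
      unfold h, a, minus, plus, opp; simpl. generalize (Hfg u v); lra.
    - etransitivity; [apply @RInt_plus|].
      + now apply @ex_RInt_minus; apply Hinner.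
      + exists 0; apply HinnerB.
      + etransitivity; [|apply @plus_zero_r].
        apply f_equal. exact (is_RInt_unique _ _ _ _ (HinnerB u)). }
  rewrite (RInt_ext _ _ _ _ (fun u _ => Hg u)).
  symmetry.
  etransitivity; [apply @RInt_minus; now apply Houter|].
  etransitivity; [|apply @minus_zero_r].
  apply f_equal, is_RInt_unique. now apply RInt_Derive_fst.
Qed.

(** * The primitive of the difference of the Gauss form and the heat form *)

(* The coefficient of [x dy - y dx = r^2 dphi] in [2 PI] times the primitive, with
   [r2 = r^2]; its values at [r2 = 0] are the limits along [w = z]. *)
Definition potential (Lambda r2 z w : R) : R :=
  if Req_dec_T r2 0 then
    if Rlt_dec 0 z then / (4 * z ^ 2) - Lambda / (2 * w) else - / (4 * z ^ 2)
  else (flat (2 * w / (Lambda * r2)) - (1 + z / sqrt (r2 + z ^ 2)) / 2) / r2.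

Lemma sqrt_gt_abs (r2 z : R) : 0 < r2 -> Rabs z < sqrt (r2 + z ^ 2).
Proof.
  intros Hr. rewrite <- sqrt_Rsqr_abs. unfold Rsqr.
  apply sqrt_lt_1_alt. split; nra.
Qed.

(** Write [exp (- u) - 1 = - u * expm1_div (- u)], and [1 - z / rho = r2 / (rho (rho + z))] from
    [rho^2 - z^2 = r2]. The factor [r2] cancels, leaving a formula regular at [r2 = 0]. *)
Lemma potential_pos (Lambda r2 z w : R) :
  0 < Lambda -> 0 <= r2 -> 0 < z -> 0 < w ->
  potential Lambda r2 z w =
  / (2 * sqrt (r2 + z ^ 2) * (sqrt (r2 + z ^ 2) + z))
  - Lambda / (2 * w) * expm1_div (- (Lambda * r2 / (2 * w))).
Proof.
  intros HL Hr Hz Hw. unfold potential. destruct (Req_dec_T r2 0) as [-> | Hr0].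
  - destruct (Rlt_dec 0 z); [|lra].
    replace (- (Lambda * 0 / (2 * w))) with 0 by (field; lra).
    rewrite expm1_div_0, Rplus_0_l, sqrt_pow2 by lra. field; lra.
  - assert (HE : flat (2 * w / (Lambda * r2)) = exp (- (Lambda * r2 / (2 * w)))).
    { unfold flat. destruct (Rlt_dec 0 (2 * w / (Lambda * r2))) as [_ | H].
      - f_equal. field. lra.
      - exfalso; apply H. apply Rdiv_lt_0_compat; nra. }
    assert (Hm := expm1_div_mult (- (Lambda * r2 / (2 * w)))).
    rewrite HE. replace (exp (- (Lambda * r2 / (2 * w)))) with
      (1 - Lambda * r2 / (2 * w) * expm1_div (- (Lambda * r2 / (2 * w)))) by lra.
    generalize (expm1_div (- (Lambda * r2 / (2 * w)))); intros m.
    assert (Hs := sqrt_gt_abs r2 z ltac:(lra)). apply Rabs_def2 in Hs.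
    assert (Hs2 : sqrt (r2 + z ^ 2) ^ 2 = r2 + z ^ 2) by (apply pow2_sqrt; nra).
    set (rho := sqrt (r2 + z ^ 2)) in *.
    (* In factored form the cancellation is visible to [field]; both factors are nonzero because
       [Rabs z < rho]. *)
    replace r2 with ((rho - z) * (rho + z)) by (replace r2 with (rho ^ 2 - z ^ 2) by lra; ring).
    field. repeat split; lra.
Qed.

(** Here the exponential is replaced by [0], and [1 + z / rho = r2 / (rho (rho - z))] supplies the
    factor [r2]. *)
Lemma potential_neg (Lambda r2 z w : R) :
  0 < Lambda -> 0 <= r2 -> z < 0 -> w < 0 ->
  potential Lambda r2 z w =
  - / (2 * sqrt (r2 + z ^ 2) * (sqrt (r2 + z ^ 2) - z)).
Proof.
  intros HL Hr Hz Hw. unfold potential. destruct (Req_dec_T r2 0) as [-> | Hr0].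
  - destruct (Rlt_dec 0 z); [lra|].
    replace (0 + z ^ 2) with ((- z) ^ 2) by ring.
    rewrite sqrt_pow2 by lra. field; lra.
  - assert (HE : flat (2 * w / (Lambda * r2)) = 0).
    { unfold flat. destruct (Rlt_dec 0 (2 * w / (Lambda * r2))) as [H | _]; trivial.
      assert (0 < / (Lambda * r2)) by (apply Rinv_0_lt_compat; nra).
      unfold Rdiv in H. nra. }
    rewrite HE.
    assert (Hs := sqrt_gt_abs r2 z ltac:(lra)). apply Rabs_def2 in Hs.
    assert (Hs2 : sqrt (r2 + z ^ 2) ^ 2 = r2 + z ^ 2) by (apply pow2_sqrt; nra).
    set (rho := sqrt (r2 + z ^ 2)) in *.
    replace r2 with ((rho - z) * (rho + z)) by (replace r2 with (rho ^ 2 - z ^ 2) by lra; ring).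
    field. repeat split; lra.
Qed.

(** On the axis [w = z <> 0], so [z] and [w] keep a common sign nearby and one of the two regular
    formulas applies. Off the axis [r2 > 0] nearby and the quotient formula applies, [flat] being
    C^1 also across [w = 0]. *)
Lemma C1_2d_potential (Lambda : R) (r2 z w : R -> R -> R) (u v : R) :
  0 < Lambda -> (forall s t, 0 <= r2 s t) ->
  C1_2d_at r2 u v -> C1_2d_at z u v -> C1_2d_at w u v ->
  (r2 u v = 0 -> z u v <> 0 /\ w u v = z u v) ->
  C1_2d_at (fun s t => potential Lambda (r2 s t) (z s t) (w s t)) u v.
Proof.
  intros HL Hr Cr Cz Cw H0.
  assert (pos_near : forall F : R -> R -> R, C1_2d_at F u v -> 0 < F u v ->
    locally (u, v) (fun q => 0 < F (fst q) (snd q))).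
  { intros F CF HF. exact (C1_2d_continuous _ _ _ CF _ (open_gt 0 _ HF)). }
  assert (neg_near : forall F : R -> R -> R, C1_2d_at F u v -> F u v < 0 ->
    locally (u, v) (fun q => F (fst q) (snd q) < 0)).
  { intros F CF HF. exact (C1_2d_continuous _ _ _ CF _ (open_lt 0 _ HF)). }
  assert (Cz2 : C1_2d_at (fun s t => r2 s t + z s t ^ 2) u v).
  { apply C1_2d_plus; trivial. simpl.
    apply C1_2d_mult; trivial. apply C1_2d_mult; trivial. apply C1_2d_const. }
  assert (Hpos : 0 < r2 u v + z u v ^ 2).
  { destruct (Hr u v) as [H | H]; [nra|].
    destruct (H0 (eq_sym H)) as [Hz _]. rewrite <- H.
    assert (0 < z u v ^ 2) by (apply pow2_gt_0; trivial). lra. }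
  assert (Crho := C1_2d_sqrt (fun s t => r2 s t + z s t ^ 2) u v Hpos Cz2).
  assert (Hrho := sqrt_lt_R0 _ Hpos).
  destruct (Req_dec_T (r2 u v) 0) as [Hr0 | Hr0].
  - destruct (H0 Hr0) as [Hz0 Hwz].
    destruct (Rlt_dec 0 (z u v)) as [Hz | Hz].
    + apply C1_2d_ext_loc with (fun s t =>
        / (2 * sqrt (r2 s t + z s t ^ 2) * (sqrt (r2 s t + z s t ^ 2) + z s t))
        - Lambda / (2 * w s t) * expm1_div (- (Lambda * r2 s t / (2 * w s t)))).
      * assert (Hw : 0 < w u v) by lra.
        generalize (filter_and _ _ (pos_near _ Cz Hz) (pos_near _ Cw Hw)).
        apply filter_imp; intros q [A B]. symmetry. now apply potential_pos.
      * assert (C2w : C1_2d_at (fun s t => / (2 * w s t)) u v).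
        { apply C1_2d_inv; [lra|]. apply C1_2d_mult; trivial. apply C1_2d_const. }
        apply C1_2d_minus.
        -- apply C1_2d_inv; [apply Rgt_not_eq; nra|].
           apply C1_2d_mult; [|now apply C1_2d_plus].
           apply C1_2d_mult; trivial. apply C1_2d_const.
        -- apply C1_2d_mult; [apply C1_2d_mult; trivial; apply C1_2d_const|].
           apply C1_2d_comp; [apply C1_expm1_div|].
           apply C1_2d_opp, C1_2d_mult; trivial.
           apply C1_2d_mult; trivial. apply C1_2d_const.
    + apply C1_2d_ext_loc with (fun s t =>
        - / (2 * sqrt (r2 s t + z s t ^ 2) * (sqrt (r2 s t + z s t ^ 2) - z s t))).
      * assert (Hw : w u v < 0) by lra.
        assert (Hz' : z u v < 0) by lra.
        generalize (filter_and _ _ (neg_near _ Cz Hz') (neg_near _ Cw Hw)).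
        apply filter_imp; intros q [A B]. symmetry. now apply potential_neg.
      * apply C1_2d_opp, C1_2d_inv; [apply Rgt_not_eq; nra|].
        apply C1_2d_mult; [|now apply C1_2d_minus].
        apply C1_2d_mult; trivial. apply C1_2d_const.
  - assert (Hr1 : 0 < r2 u v) by (generalize (Hr u v); lra).
    apply C1_2d_ext_loc with (fun s t =>
      (flat (2 * w s t / (Lambda * r2 s t))
       - (1 + z s t / sqrt (r2 s t + z s t ^ 2)) / 2) / r2 s t).
    + generalize (pos_near _ Cr Hr1). apply filter_imp; intros q A.
      unfold potential.
      destruct (Req_dec_T (r2 (fst q) (snd q)) 0); [lra | reflexivity].
    + apply C1_2d_mult; [|now apply C1_2d_inv].
      apply C1_2d_minus.
      * apply C1_2d_comp; [apply C1_flat|].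
        apply C1_2d_mult; [apply C1_2d_mult; trivial; apply C1_2d_const|].
        apply C1_2d_inv; [apply Rgt_not_eq; nra|].
        apply C1_2d_mult; trivial; apply C1_2d_const.
      * apply C1_2d_mult; [|apply C1_2d_const].
        apply C1_2d_plus; [apply C1_2d_const|].
        apply C1_2d_mult; trivial. apply C1_2d_inv; trivial. lra.
Qed.

(** * The differential of the potential and the pointwise identity of 2-forms *)

Definition dpotential (Lambda r2 z w dr2 dz dw : R) : R :=
  let rho := sqrt (r2 + z ^ 2) in
  let v := 2 * w / (Lambda * r2) in
  (flat v / v ^ 2 * (2 * (dw * r2 - w * dr2) / (Lambda * r2 ^ 2))
   - (dz * r2 - z * dr2 / 2) / rho ^ 3 / 2) / r2
  - (flat v - (1 + z / rho) / 2) * dr2 / r2 ^ 2.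

(** The quotient rule, with [flat' v = flat v / v^2] and [d (z / rho) = (r2 dz - z dr2 / 2) /
    rho^3]. *)
Lemma is_derive_potential (Lambda : R) (r2 z w : R -> R) (t r2' z' w' : R) :
  0 < Lambda -> 0 < r2 t ->
  is_derive r2 t r2' -> is_derive z t z' -> is_derive w t w' ->
  is_derive (fun s => potential Lambda (r2 s) (z s) (w s)) t
    (dpotential Lambda (r2 t) (z t) (w t) r2' z' w').
Proof.
  intros HL Hr Dr Dz Dw. unfold dpotential.
  set (rho := sqrt (r2 t + z t ^ 2)). set (v := 2 * w t / (Lambda * r2 t)).
  apply is_derive_ext_loc with (fun s =>
    (flat (2 * w s / (Lambda * r2 s)) - (1 + z s / sqrt (r2 s + z s ^ 2)) / 2) / r2 s).
  - assert (HN : locally t (fun s => 0 < r2 s)).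
    { assert (C : continuous r2 t)
        by (apply (@ex_derive_continuous R_AbsRing R_NormedModule); now exists r2').
      exact (C _ (open_gt 0 _ Hr)). }
    revert HN; apply filter_imp; intros s Hs.
    unfold potential. destruct (Req_dec_T (r2 s) 0); [lra | reflexivity].
  - assert (Hpos : 0 < r2 t + z t ^ 2) by nra.
    assert (Hrho : 0 < rho) by now apply sqrt_lt_R0.
    assert (Hrho2 : rho ^ 2 = r2 t + z t ^ 2) by (apply pow2_sqrt; lra).
    auto_derive.
    + repeat split; try (eexists; eassumption); try lra; try nra.
      * eexists; apply is_derive_flat.
      * now apply Rgt_not_eq.
    + rewrite (is_derive_unique (fun x : R => r2 x) t r2') by trivial.
      rewrite (is_derive_unique (fun x : R => z x) t z') by trivial.
      rewrite (is_derive_unique (fun x : R => w x) t w') by trivial.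
      change (r2 t + z t * (z t * 1)) with (r2 t + z t ^ 2).
      change (2 * w t * / (Lambda * r2 t)) with v.
      rewrite (is_derive_unique (fun x : R => flat x) v _ (is_derive_flat v)).
      fold rho.
      generalize (flat v / v ^ 2); generalize (flat v); intros f f'.
      (* Eliminating [r2] in favour of [rho] turns the goal into an identity of rational functions
         in independent variables. *)
      replace (r2 t) with (rho ^ 2 - z t ^ 2) in * by lra.
      field. repeat split; lra.
Qed.

(** The right-hand side is [d (P (x dy - y dx)) / (2 PI)] on two tangent vectors, [P] being the
    potential: [dP] wedge [(x dy - y dx)] plus [2 P dx dy]. The heights [c] and [w] are independent,
    since each form is [d] of a function of its own height times [dphi]. *)
Lemma gauss_minus_heat (Lambda a b c w a1 b1 c1 w1 a2 b2 c2 w2 : R) :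
  0 < Lambda -> 0 < a ^ 2 + b ^ 2 ->
  let r2 := a ^ 2 + b ^ 2 in
  / (4 * PI) * / norm3 (a, b, c) ^ 3 * sphere_area (a, b, c) (a1, b1, c1) (a2, b2, c2)
  - heat_form Lambda (a, b, w) (a1, b1, w1) (a2, b2, w2) =
  / (2 * PI) *
    (dpotential Lambda r2 c w (2 * (a * a1 + b * b1)) c1 w1 * (a * b2 - b * a2)
     - dpotential Lambda r2 c w (2 * (a * a2 + b * b2)) c2 w2 * (a * b1 - b * a1)
     + 2 * potential Lambda r2 c w * (a1 * b2 - a2 * b1)).
Proof.
  intros HL Hr r2. fold r2 in Hr.
  unfold potential. destruct (Req_dec_T r2 0); [lra|].
  change (norm3 (a, b, c)) with (sqrt (r2 + c ^ 2)).
  unfold dpotential.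
  set (rho := sqrt (r2 + c ^ 2)). set (v := 2 * w / (Lambda * r2)).
  assert (HPI := PI_RGT_0).
  assert (Hrho : 0 < rho) by (apply sqrt_lt_R0; nra).
  unfold sphere_area, heat_form, wedge, dx, dy, dz, xc, yc, zc; cbn [fst snd].
  (* From here [rho] is any positive number: the relation [rho^2 = r2 + c^2] is already built into
     the formula for [d (z / rho)]. *)
  clearbody rho.
  destruct (Rlt_dec 0 w) as [Hw | Hw].
  - assert (Hv : 0 < v) by (apply Rdiv_lt_0_compat; nra).
    replace (exp (- Lambda * (a ^ 2 + b ^ 2) / (2 * w))) with (flat v).
    + generalize (flat v); intros f. unfold v, r2 in *. field. repeat split; lra.
    + unfold flat. destruct (Rlt_dec 0 v); [|lra].
      f_equal. unfold v, r2 in *. field. lra.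
  - assert (Hf : flat v = 0).
    { unfold flat. destruct (Rlt_dec 0 v) as [Hv|]; trivial.
      assert (0 < / (Lambda * r2)) by (apply Rinv_0_lt_compat; nra).
      unfold v, Rdiv in Hv. nra. }
    rewrite Hf. generalize (/ v ^ 2); intros v'. unfold r2 in *.
    (* For [w <= 0] the number [v] may be [0], so the terms in [flat v / v^2] are removed as
       products with [0] before [field] could ask for [v <> 0]. *)
    unfold Rdiv. rewrite !Rmult_0_l.
    field. repeat split; lra.
Qed.

(** On the axis [x dy - y dx] vanishes and only [2 P dx dy] remains. The Gauss form is
    [c / (4 PI |c|^3) dx dy], and the heat form is [Lambda / (2 PI c) dx dy] or [0] by the sign of
    [c], which matches the values of [potential] at [r2 = 0]. *)
Lemma gauss_minus_heat_axis (Lambda c a1 b1 c1 w1 a2 b2 c2 w2 : R) :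
  0 < Lambda -> c <> 0 ->
  / (4 * PI) * / norm3 (0, 0, c) ^ 3 * sphere_area (0, 0, c) (a1, b1, c1) (a2, b2, c2)
  - heat_form Lambda (0, 0, c) (a1, b1, w1) (a2, b2, w2) =
  / (2 * PI) * (2 * potential Lambda 0 c c * (a1 * b2 - a2 * b1)).
Proof.
  intros HL Hc.
  assert (HPI := PI_RGT_0).
  assert (Hn : norm3 (0, 0, c) = Rabs c).
  { unfold norm3, xc, yc, zc; cbn [fst snd].
    rewrite <- sqrt_Rsqr_abs. f_equal. unfold Rsqr. ring. }
  rewrite Hn.
  unfold potential. destruct (Req_dec_T 0 0) as [_|]; [|lra].
  unfold sphere_area, heat_form, wedge, dx, dy, dz, xc, yc, zc; cbn [fst snd].
  destruct (Rlt_dec 0 c) as [Hp | Hp].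
  - rewrite Rabs_pos_eq by lra.
    replace (- Lambda * (0 ^ 2 + 0 ^ 2) / (2 * c)) with 0 by (field; lra).
    rewrite exp_0. field. lra.
  - rewrite Rabs_left by lra. field. lra.
Qed.

(** * Pullbacks to the torus *)

(** Leibniz' rule for [G] times [1 / |G|]. The radial coefficient [q] stays unspecified, as it
    cancels in the area form. *)
Lemma derive3_unit3 (G : R -> R3) (t : R) :
  ex_derive (fun s => xc (G s)) t ->
  ex_derive (fun s => yc (G s)) t ->
  ex_derive (fun s => zc (G s)) t ->
  norm3 (G t) <> 0 ->
  exists q, derive3 (fun s => unit3 (G s)) t =
    (xc (derive3 G t) / norm3 (G t) + q * xc (G t),
     yc (derive3 G t) / norm3 (G t) + q * yc (G t),
     zc (derive3 G t) / norm3 (G t) + q * zc (G t)).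
Proof.
  intros Dx Dy Dz Hn.
  assert (Hpos : 0 < xc (G t) ^ 2 + yc (G t) ^ 2 + zc (G t) ^ 2).
  { apply Rnot_le_lt. intros H. now apply Hn, sqrt_neg_0. }
  assert (Dq : ex_derive (fun s => / norm3 (G s)) t).
  { assert (aux : forall x y z : R -> R,
      ex_derive x t -> ex_derive y t -> ex_derive z t ->
      0 < x t ^ 2 + y t ^ 2 + z t ^ 2 ->
      ex_derive (fun s => / sqrt (x s ^ 2 + y s ^ 2 + z s ^ 2)) t).
    { intros x y z Ex Ey Ez H. auto_derive. repeat split; trivial.
      now apply Rgt_not_eq, sqrt_lt_R0. }
    now apply (aux (fun s => xc (G s)) (fun s => yc (G s)) (fun s => zc (G s))). }
  assert (Dm : forall h : R -> R, ex_derive h t ->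
    Derive (fun s => h s / norm3 (G s)) t =
    Derive h t / norm3 (G t) + Derive (fun s => / norm3 (G s)) t * h t).
  { intros h Dh. unfold Rdiv.
    rewrite (Derive_mult h (fun s => / norm3 (G s))) by trivial. ring. }
  exists (Derive (fun s => / norm3 (G s)) t).
  unfold derive3 at 1. apply f_equal2; [apply f_equal2|].
  - exact (Dm _ Dx).
  - exact (Dm _ Dy).
  - exact (Dm _ Dz).
Qed.

(* The radial part of the derivative of [unit3 F] drops out of the determinant. *)
Lemma pullback_unit3 (F : R -> R -> R3) (u v : R) :
  C1_2d_at (fun s t => xc (F s t)) u v ->
  C1_2d_at (fun s t => yc (F s t)) u v ->
  C1_2d_at (fun s t => zc (F s t)) u v ->
  norm3 (F u v) <> 0 ->
  pullback (fun s t => unit3 (F s t))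
    (fun p a b => / (4 * PI) * sphere_area p a b) u v =
  / (4 * PI) * / norm3 (F u v) ^ 3 *
    sphere_area (F u v) (derive3 (fun s => F s v) u) (derive3 (fun t => F u t) v).
Proof.
  intros Cx Cy Cz Hn.
  assert (HPI := PI_RGT_0).
  destruct (C1_2d_ex_derive _ _ _ Cx) as [Dx1 Dx2].
  destruct (C1_2d_ex_derive _ _ _ Cy) as [Dy1 Dy2].
  destruct (C1_2d_ex_derive _ _ _ Cz) as [Dz1 Dz2].
  unfold pullback.
  destruct (derive3_unit3 (fun s => F s v) u Dx1 Dy1 Dz1 Hn) as [q1 ->].
  destruct (derive3_unit3 (fun t => F u t) v Dx2 Dy2 Dz2 Hn) as [q2 ->].
  destruct (derive3 (fun s => F s v) u) as [[a1 b1] c1].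
  destruct (derive3 (fun t => F u t) v) as [[a2 b2] c2].
  unfold sphere_area, unit3, wedge, dx, dy, dz. revert Hn.
  generalize (norm3 (F u v)); intros n Hn. destruct (F u v) as [[a b] c].
  unfold xc, yc, zc; cbn [fst snd].
  field. lra.
Qed.

(** The derivative is included because the coefficients of the primitive contain the velocities of
    the curves. *)
Lemma smooth_C1 (x : R -> R) (t : R) :
  (forall n t, ex_derive_n x n t) -> C1_at x t /\ C1_at (Derive x) t.
Proof.
  intros Hx. split.
  - exists (Derive x); split.
    + apply filter_forall; intros s. apply Derive_correct, (Hx 1%nat).
    + apply (@ex_derive_continuous R_AbsRing R_NormedModule), (Hx 2%nat).
  - exists (Derive (Derive x)); split.
    + apply filter_forall; intros s. apply Derive_correct, (Hx 2%nat).
    + apply (@ex_derive_continuous R_AbsRing R_NormedModule), (Hx 3%nat).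
Qed.


Lemma C1_2d_coord (p : R3 -> R) (X1 X2 : R -> R3) (u v : R) :
  (forall n t, ex_derive_n (fun s => p (X1 s)) n t) ->
  (forall n t, ex_derive_n (fun s => p (X2 s)) n t) ->
  C1_2d_at (fun s _ => p (X1 s)) u v /\ C1_2d_at (fun _ t => p (X2 t)) u v /\
  C1_2d_at (fun s _ => Derive (fun s => p (X1 s)) s) u v /\
  C1_2d_at (fun _ t => Derive (fun s => p (X2 s)) t) u v.
Proof.
  intros H1 H2.
  destruct (smooth_C1 _ u H1), (smooth_C1 _ v H2).
  repeat split; [apply C1_2d_fst | apply C1_2d_snd | apply C1_2d_fst | apply C1_2d_snd];
    trivial.
Qed.

Lemma smooth3_coords (X : R -> R3) : smooth3 X ->
  (forall n t, ex_derive_n (fun s => xc (X s)) n t) /\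
  (forall n t, ex_derive_n (fun s => yc (X s)) n t) /\
  (forall n t, ex_derive_n (fun s => zc (X s)) n t).
Proof. intros H; repeat split; intros n t; apply (H n t). Qed.

(** * The primitive on the torus *)

Definition chord (X1 X2 : R -> R3) (u v : R) : R3 := sub3 (X2 v) (X1 u).
Definition heis_chord (X1 X2 : R -> R3) (u v : R) : R3 := heisenberg_diff (X1 u) (X2 v).

Definition torus_potential (Lambda : R) (X1 X2 : R -> R3) (u v : R) : R :=
  potential Lambda (xc (chord X1 X2 u v) ^ 2 + yc (chord X1 X2 u v) ^ 2)
    (zc (chord X1 X2 u v)) (zc (heis_chord X1 X2 u v)).



(** For equal horizontal coordinates the correction [x1 y2 - x2 y1] is [0], so both heights agree;
    they are nonzero because the two points differ. *)
Lemma chord_neq_0 (X1 X2 : R -> R3) (u v : R) :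
  X1 u <> X2 v ->
  xc (chord X1 X2 u v) ^ 2 + yc (chord X1 X2 u v) ^ 2 = 0 ->
  xc (chord X1 X2 u v) = 0 /\ yc (chord X1 X2 u v) = 0 /\
  zc (chord X1 X2 u v) <> 0 /\ zc (heis_chord X1 X2 u v) = zc (chord X1 X2 u v).
Proof.
  unfold chord, heis_chord, sub3, heisenberg_diff.
  destruct (X1 u) as [[x1 y1] z1], (X2 v) as [[x2 y2] z2].
  unfold xc, yc, zc; cbn [fst snd]. intros Hd H0.
  rewrite <- !Rsqr_pow2 in H0.
  destruct (Rplus_sqr_eq_0 _ _ H0) as [Hx Hy].
  apply Rminus_diag_uniq in Hx, Hy.
  subst.
  repeat split; try ring. intros Hz. apply Hd. repeat f_equal. lra.
Qed.

Lemma C1_2d_chord (X1 X2 : R -> R3) (u v : R) : smooth3 X1 -> smooth3 X2 ->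
  C1_2d_at (fun s t => xc (chord X1 X2 s t)) u v /\
  C1_2d_at (fun s t => yc (chord X1 X2 s t)) u v /\
  C1_2d_at (fun s t => zc (chord X1 X2 s t)) u v /\
  C1_2d_at (fun s t => zc (heis_chord X1 X2 s t)) u v.
Proof.
  intros H1 H2.
  destruct (smooth3_coords _ H1) as (Hx1 & Hy1 & Hz1).
  destruct (smooth3_coords _ H2) as (Hx2 & Hy2 & Hz2).
  destruct (C1_2d_coord xc X1 X2 u v Hx1 Hx2) as (Cx1 & Cx2 & _).
  destruct (C1_2d_coord yc X1 X2 u v Hy1 Hy2) as (Cy1 & Cy2 & _).
  destruct (C1_2d_coord zc X1 X2 u v Hz1 Hz2) as (Cz1 & Cz2 & _).
  repeat split.
  - exact (C1_2d_minus _ _ _ _ Cx2 Cx1).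
  - exact (C1_2d_minus _ _ _ _ Cy2 Cy1).
  - exact (C1_2d_minus _ _ _ _ Cz2 Cz1).
  - exact (C1_2d_minus _ _ _ _
      (C1_2d_plus _ _ _ _ (C1_2d_minus _ _ _ _ Cz2 Cz1) (C1_2d_mult _ _ _ _ Cx1 Cy2))
      (C1_2d_mult _ _ _ _ Cx2 Cy1)).
Qed.

Lemma C1_2d_torus_potential (Lambda : R) (X1 X2 : R -> R3) (u v : R) :
  smooth3 X1 -> smooth3 X2 -> 0 < Lambda -> X1 u <> X2 v ->
  C1_2d_at (torus_potential Lambda X1 X2) u v.
Proof.
  intros H1 H2 HL Hd.
  destruct (C1_2d_chord X1 X2 u v H1 H2) as (Cx & Cy & Cz & Cw).
  apply (C1_2d_potential Lambda
    (fun s t => xc (chord X1 X2 s t) ^ 2 + yc (chord X1 X2 s t) ^ 2)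
    (fun s t => zc (chord X1 X2 s t)) (fun s t => zc (heis_chord X1 X2 s t))); trivial.
  - intros s t. apply Rplus_le_le_0_compat; apply pow2_ge_0.
  - simpl. apply C1_2d_plus; apply C1_2d_mult; trivial; apply C1_2d_mult; trivial;
      apply C1_2d_const.
  - intros H0. now apply chord_neq_0.
Qed.

(** The pulled-back 1-form is [primitive1 dtheta1 + primitive2 dtheta2]. The minus signs come from
    the chord [X2 - X1], whose derivative in the first angle is [- X1']. *)
Definition primitive1 (Lambda : R) (X1 X2 : R -> R3) (u v : R) : R :=
  / (2 * PI) * (torus_potential Lambda X1 X2 u v *
    (xc (chord X1 X2 u v) * - Derive (fun s => yc (X1 s)) u
     - yc (chord X1 X2 u v) * - Derive (fun s => xc (X1 s)) u)).

Definition primitive2 (Lambda : R) (X1 X2 : R -> R3) (u v : R) : R :=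
  / (2 * PI) * (torus_potential Lambda X1 X2 u v *
    (xc (chord X1 X2 u v) * Derive (fun t => yc (X2 t)) v
     - yc (chord X1 X2 u v) * Derive (fun t => xc (X2 t)) v)).

Lemma C1_2d_primitives (Lambda : R) (X1 X2 : R -> R3) (u v : R) :
  smooth3 X1 -> smooth3 X2 -> 0 < Lambda -> X1 u <> X2 v ->
  C1_2d_at (primitive1 Lambda X1 X2) u v /\ C1_2d_at (primitive2 Lambda X1 X2) u v.
Proof.
  intros H1 H2 HL Hd.
  destruct (C1_2d_chord X1 X2 u v H1 H2) as (Cx & Cy & _).
  assert (CP := C1_2d_torus_potential Lambda X1 X2 u v H1 H2 HL Hd).
  destruct (smooth3_coords _ H1) as (Hx1 & Hy1 & _).
  destruct (smooth3_coords _ H2) as (Hx2 & Hy2 & _).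
  destruct (C1_2d_coord xc X1 X2 u v Hx1 Hx2) as (_ & _ & Dx1 & Dx2).
  destruct (C1_2d_coord yc X1 X2 u v Hy1 Hy2) as (_ & _ & Dy1 & Dy2).
  split.
  - exact (C1_2d_mult _ _ _ _ (C1_2d_const _ _ _) (C1_2d_mult _ _ _ _ CP
      (C1_2d_minus _ _ _ _ (C1_2d_mult _ _ _ _ Cx (C1_2d_opp _ _ _ Dy1))
                           (C1_2d_mult _ _ _ _ Cy (C1_2d_opp _ _ _ Dx1))))).
  - exact (C1_2d_mult _ _ _ _ (C1_2d_const _ _ _) (C1_2d_mult _ _ _ _ CP
      (C1_2d_minus _ _ _ _ (C1_2d_mult _ _ _ _ Cx Dy2)
                           (C1_2d_mult _ _ _ _ Cy Dx2)))).
Qed.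

Lemma norm3_chord_neq_0 (X1 X2 : R -> R3) (u v : R) :
  X1 u <> X2 v -> norm3 (chord X1 X2 u v) <> 0.
Proof.
  intros Hd. apply Rgt_not_eq, sqrt_lt_R0.
  assert (Hx := pow2_ge_0 (xc (chord X1 X2 u v))).
  assert (Hy := pow2_ge_0 (yc (chord X1 X2 u v))).
  assert (Hz := pow2_ge_0 (zc (chord X1 X2 u v))).
  destruct (Req_dec (xc (chord X1 X2 u v) ^ 2 + yc (chord X1 X2 u v) ^ 2) 0) as [H | H].
  - destruct (chord_neq_0 _ _ _ _ Hd H) as (_ & _ & Hz0 & _).
    apply pow2_gt_0 in Hz0. lra.
  - lra.
Qed.

Lemma Derive_const_minus (f : R -> R) (t c : R) :
  ex_derive f t -> Derive (fun s => c - f s) t = - Derive f t.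
Proof.
  intros Hf. apply is_derive_unique. auto_derive; trivial.
  change (fun x : R => f x) with f. ring.
Qed.

Lemma Derive_minus_const (f : R -> R) (t c : R) :
  ex_derive f t -> Derive (fun s => f s - c) t = Derive f t.
Proof.
  intros Hf. apply is_derive_unique. auto_derive; trivial.
  change (fun x : R => f x) with f. ring.
Qed.

(** The constants [k] and [m] are velocity components in the other angle: the chord is a difference
    of functions of one angle each, so its mixed second derivatives vanish. *)
Lemma Derive_angular (P a b : R -> R) (t k m : R) :
  ex_derive P t -> ex_derive a t -> ex_derive b t ->
  Derive (fun s => / (2 * PI) * (P s * (a s * k - b s * m))) t =
  / (2 * PI) * (Derive P t * (a t * k - b t * m)
                + P t * (Derive a t * k - Derive b t * m)).
Proof.
  intros HP Ha Hb. apply is_derive_unique. auto_derive; [tauto|].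
  change (fun x : R => P x) with P. change (fun x : R => a x) with a.
  change (fun x : R => b x) with b. ring.
Qed.

Lemma Derive_potential (Lambda : R) (x y z w : R -> R) (t : R) :
  0 < Lambda -> ex_derive x t -> ex_derive y t -> ex_derive z t -> ex_derive w t ->
  0 < x t ^ 2 + y t ^ 2 ->
  Derive (fun s => potential Lambda (x s ^ 2 + y s ^ 2) (z s) (w s)) t =
  dpotential Lambda (x t ^ 2 + y t ^ 2) (z t) (w t)
    (2 * (x t * Derive x t + y t * Derive y t)) (Derive z t) (Derive w t).
Proof.
  intros HL Hx Hy Hz Hw Hr. apply is_derive_unique.
  apply (is_derive_potential Lambda (fun s => x s ^ 2 + y s ^ 2) z w); trivial;
    try now apply Derive_correct.
  auto_derive; [tauto|].
  change (fun x0 : R => x x0) with x. change (fun x0 : R => y x0) with y. ring.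
Qed.

Lemma pullback_minus_exact (Lambda : R) (X1 X2 : R -> R3) (u v : R) :
  smooth3 X1 -> smooth3 X2 -> 0 < Lambda -> X1 u <> X2 v ->
  pullback (fun s t => unit3 (chord X1 X2 s t))
    (fun p a b => / (4 * PI) * sphere_area p a b) u v
  - pullback (heis_chord X1 X2) (heat_form Lambda) u v =
  Derive (fun s => primitive2 Lambda X1 X2 s v) u
  - Derive (fun t => primitive1 Lambda X1 X2 u t) v.
Proof.
  intros H1 H2 HL Hd.
  destruct (C1_2d_chord X1 X2 u v H1 H2) as (Cx & Cy & Cz & Cw).
  rewrite pullback_unit3 by (trivial; now apply norm3_chord_neq_0).
  unfold pullback.
  assert (CP := C1_2d_torus_potential Lambda X1 X2 u v H1 H2 HL Hd).
  destruct (C1_2d_ex_derive _ _ _ Cx) as [Dx1 Dx2].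
  destruct (C1_2d_ex_derive _ _ _ Cy) as [Dy1 Dy2].
  destruct (C1_2d_ex_derive _ _ _ Cz) as [Dz1 Dz2].
  destruct (C1_2d_ex_derive _ _ _ Cw) as [Dw1 Dw2].
  destruct (C1_2d_ex_derive _ _ _ CP) as [DP1 DP2].
  destruct (smooth3_coords _ H1) as (Hx1 & Hy1 & _).
  destruct (smooth3_coords _ H2) as (Hx2 & Hy2 & _).
  unfold primitive1, primitive2.
  rewrite (Derive_angular (fun s => torus_potential Lambda X1 X2 s v)
    (fun s => xc (chord X1 X2 s v)) (fun s => yc (chord X1 X2 s v))) by trivial.
  rewrite (Derive_angular (torus_potential Lambda X1 X2 u)
    (fun t => xc (chord X1 X2 u t)) (fun t => yc (chord X1 X2 u t))) by trivial.
  (* The velocities of the curves are rewritten as partial derivatives of the chord, the tangent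
     vectors of the pointwise identity. *)
  rewrite <- (Derive_const_minus (fun s => xc (X1 s)) u (xc (X2 v)) (Hx1 1%nat u)).
  rewrite <- (Derive_const_minus (fun s => yc (X1 s)) u (yc (X2 v)) (Hy1 1%nat u)).
  rewrite <- (Derive_minus_const (fun t => xc (X2 t)) v (xc (X1 u)) (Hx2 1%nat v)).
  rewrite <- (Derive_minus_const (fun t => yc (X2 t)) v (yc (X1 u)) (Hy2 1%nat v)).
  set (x := fun s t => xc (chord X1 X2 s t)) in *.
  set (y := fun s t => yc (chord X1 X2 s t)) in *.
  set (z := fun s t => zc (chord X1 X2 s t)) in *.
  set (w := fun s t => zc (heis_chord X1 X2 s t)) in *.
  set (P := torus_potential Lambda X1 X2) in *.
  change (chord X1 X2 u v) with (x u v, y u v, z u v).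
  change (heis_chord X1 X2 u v) with (x u v, y u v, w u v).
  change (derive3 (fun s => chord X1 X2 s v) u) with
    (Derive (fun s => x s v) u, Derive (fun s => y s v) u, Derive (fun s => z s v) u).
  change (derive3 (fun t => chord X1 X2 u t) v) with
    (Derive (fun t => x u t) v, Derive (fun t => y u t) v, Derive (fun t => z u t) v).
  change (derive3 (fun s => heis_chord X1 X2 s v) u) with
    (Derive (fun s => x s v) u, Derive (fun s => y s v) u, Derive (fun s => w s v) u).
  change (derive3 (fun t => heis_chord X1 X2 u t) v) with
    (Derive (fun t => x u t) v, Derive (fun t => y u t) v, Derive (fun t => w u t) v).
  change (Derive (fun s => xc (X2 v) - xc (X1 s)) u) with (Derive (fun s => x s v) u).
  change (Derive (fun s => yc (X2 v) - yc (X1 s)) u) with (Derive (fun s => y s v) u).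
  change (Derive (fun t => xc (X2 t) - xc (X1 u)) v) with (Derive (fun t => x u t) v).
  change (Derive (fun t => yc (X2 t) - yc (X1 u)) v) with (Derive (fun t => y u t) v).
  change (xc (x u v, y u v, z u v)) with (x u v).
  change (yc (x u v, y u v, z u v)) with (y u v).
  change (Derive (fun s => xc (chord X1 X2 s v)) u) with (Derive (fun s => x s v) u).
  change (Derive (fun s => yc (chord X1 X2 s v)) u) with (Derive (fun s => y s v) u).
  change (Derive (fun t => xc (chord X1 X2 u t)) v) with (Derive (fun t => x u t) v).
  change (Derive (fun t => yc (chord X1 X2 u t)) v) with (Derive (fun t => y u t) v).
  destruct (Req_dec (x u v ^ 2 + y u v ^ 2) 0) as [Hr | Hr].
  - destruct (chord_neq_0 _ _ _ _ Hd Hr) as (Hx & Hy & Hz & Hw).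
    assert (HP : P u v = potential Lambda 0 (z u v) (z u v)).
    { change (w u v = z u v) in Hw.
      change (P u v) with (potential Lambda (x u v ^ 2 + y u v ^ 2) (z u v) (w u v)).
      now rewrite Hr, Hw. }
    change (x u v = 0) in Hx. change (y u v = 0) in Hy. change (w u v = z u v) in Hw.
    (* The derivatives of [P] are multiplied by [x = y = 0], so only its value enters. *)
    rewrite Hw, Hx, Hy, gauss_minus_heat_axis by trivial.
    rewrite HP. ring.
  - assert (Hr0 : 0 < x u v ^ 2 + y u v ^ 2)
      by (generalize (pow2_ge_0 (x u v)) (pow2_ge_0 (y u v)); lra).
    rewrite gauss_minus_heat by trivial. cbv zeta.
    change (Derive (fun s => P s v) u) with (Derive (fun s =>
      potential Lambda (x s v ^ 2 + y s v ^ 2) (z s v) (w s v)) u).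
    change (Derive (P u) v) with (Derive (fun t =>
      potential Lambda (x u t ^ 2 + y u t ^ 2) (z u t) (w u t)) v).
    rewrite (Derive_potential Lambda (fun s => x s v) (fun s => y s v)
      (fun s => z s v) (fun s => w s v)) by trivial.
    rewrite (Derive_potential Lambda (fun t => x u t) (fun t => y u t)
      (fun t => z u t) (fun t => w u t)) by trivial.
    change (P u v) with (potential Lambda (x u v ^ 2 + y u v ^ 2) (z u v) (w u v)).
    ring.
Qed.

(** Supplies the continuous integrand [f] of [integral_T2_exact]: after [pullback_unit3] it involves
    only [F] and its first partial derivatives. *)
Lemma C0_2d_pullback_unit3 (F : R -> R -> R3) :
  (forall u v, C1_2d_at (fun s t => xc (F s t)) u v) ->
  (forall u v, C1_2d_at (fun s t => yc (F s t)) u v) ->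
  (forall u v, C1_2d_at (fun s t => zc (F s t)) u v) ->
  (forall u v, norm3 (F u v) <> 0) ->
  C0_2d (pullback (fun s t => unit3 (F s t))
    (fun p a b => / (4 * PI) * sphere_area p a b)).
Proof.
  intros Cx Cy Cz Hn u v.
  apply continuous_ext with (fun q : R * R =>
    / (4 * PI) * / norm3 (F (fst q) (snd q)) ^ 3 *
    sphere_area (F (fst q) (snd q)) (derive3 (fun s => F s (snd q)) (fst q))
      (derive3 (fun t => F (fst q) t) (snd q))).
  { intros q. symmetry. now apply pullback_unit3. }
  assert (Hc := fun G H => C1_2d_continuous G u v (H u v)).
  assert (Hd := fun G H => C1_2d_continuous_Derive G u v (H u v)).
  destruct (Hd _ Cx) as [Dx1 Dx2], (Hd _ Cy) as [Dy1 Dy2], (Hd _ Cz) as [Dz1 Dz2].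
  apply Hc in Cx. apply Hc in Cy. apply Hc in Cz.
  assert (Cm : forall f g : R * R -> R, continuous f (u, v) -> continuous g (u, v) ->
    continuous (fun q => f q * g q) (u, v)) by (intros; now apply @continuous_mult).
  assert (Cp : forall f g : R * R -> R, continuous f (u, v) -> continuous g (u, v) ->
    continuous (fun q => f q + g q) (u, v)) by (intros; now apply @continuous_plus).
  assert (Cs : forall f g : R * R -> R, continuous f (u, v) -> continuous g (u, v) ->
    continuous (fun q => f q - g q) (u, v)) by (intros; now apply @continuous_minus).
  assert (Cn : continuous (fun q : R * R => norm3 (F (fst q) (snd q))) (u, v)).
  { apply (continuous_comp _ sqrt); [|apply continuous_sqrt].
    assert (Csq : forall f : R * R -> R, continuous f (u, v) ->
      continuous (fun q => f q ^ 2) (u, v)).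
    { intros f Hf. apply Cm; trivial. apply Cm; trivial. apply continuous_const. }
    repeat apply Cp; now apply Csq. }
  apply Cm.
  - apply Cm; [apply continuous_const|].
    apply (continuous_comp _ Rinv).
    + simpl. repeat apply Cm; trivial. apply continuous_const.
    + now apply continuous_Rinv, pow_nonzero, Hn.
  - unfold sphere_area, wedge, dx, dy, dz.
    apply Cp; [apply Cs|]; (apply Cm; [trivial|]; apply Cs; apply Cm; trivial).
Qed.

Theorem proposition1p1 (X1 X2 : R -> R3)
  (hX1 : embedded_circle X1) (hX2 : embedded_circle X2)
  (hdisj : forall s t : R, X1 s <> X2 t)
  (Lambda : R) (hLambda : 0 < Lambda) :
  linking_number X1 X2 =
  integral_T2
    (pullback (fun t1 t2 => heisenberg_diff (X1 t1) (X2 t2))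
              (heat_form Lambda)).
Proof.
  assert (H1 := circle_smooth X1 hX1). assert (H2 := circle_smooth X2 hX2).
  assert (P1 := circle_periodic X1 hX1 0). assert (P2 := circle_periodic X2 hX2 0).
  rewrite Rplus_0_l in P1, P2.
  assert (C1 := fun u v => proj1 (C1_2d_primitives Lambda X1 X2 u v H1 H2 hLambda (hdisj u v))).
  assert (C2 := fun u v => proj2 (C1_2d_primitives Lambda X1 X2 u v H1 H2 hLambda (hdisj u v))).
  assert (Cc := fun u v => C1_2d_chord X1 X2 u v H1 H2).
  apply (integral_T2_exact (primitive2 Lambda X1 X2) (primitive1 Lambda X1 X2)).
  - intros u v. now apply C1_2d_continuous.
  - intros u v. apply (C1_2d_ex_derive _ _ _ (C2 u v)).
  - intros u v. apply (C1_2d_ex_derive _ _ _ (C1 u v)).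
  - intros u v. apply (C1_2d_continuous_Derive _ _ _ (C2 u v)).
  - intros u v. apply (C1_2d_continuous_Derive _ _ _ (C1 u v)).
  (* [primitive2] depends on the first angle only through the point of [X1], so [X1 (2 * PI) = X1 0]
     closes the boundary term; likewise for [primitive1] and [X2]. *)
  - intros v. unfold primitive2, torus_potential, chord, heis_chord. now rewrite P1.
  - intros u. unfold primitive1, torus_potential, chord, heis_chord. now rewrite P2.
  - apply (C0_2d_pullback_unit3 (chord X1 X2)); intros u v; try apply (Cc u v).
    now apply norm3_chord_neq_0.
  - intros u v. now apply pullback_minus_exact.
Qed.
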